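(* Let $H$ be a crossed homomorphism from a Lie algebra $\mathfrak g$ to a Lie algebra $\mathfrak h$ with respect to an action $\rho:\mathfrak g\to\mathrm{Der}(\mathfrak h)$. Then for any Nijenhuis element $x\in\mathsf{Nij}(H)$ associated to $H$, $H_t:=H+t\mathfrak H$ with $\mathfrak H:=d_{\rho_H}(-Hx)$, i.e. $\mathfrak H(y)=-\rho(y)(Hx)-[Hy,Hx]_{\mathfrak h}$ for $y\in\mathfrak g$, is a linear deformation of the crossed homomorphism $H$. Moreover, this deformation is trivial.
   Context: All vector spaces are over an algebraically closed field $\mathbb K$ of characteristic $0$. An action of $\mathfrak g$ on $\mathfrak h$ is a Lie algebra homomorphism $\rho:\mathfrak g\to\mathrm{Der}(\mathfrak h)$. A linear map $H:\mathfrak g\to\mathfrak h$ is a crossed homomorphism with respect to $\rho$ if $H[x,y]_{\mathfrak g}=\rho(x)(Hy)-\rho(y)(Hx)+[Hx,Hy]_{\mathfrak h}$ for all $x,y\in\mathfrak g$. A homomorphism from a crossed homomorphism $H'$ to a crossed homomorphism $H$ (both with respect to $\rho$) is a pair of Lie algebra homomorphisms $\phi_{\mathfrak g}:\mathfrak g\to\mathfrak g$, $\phi_{\mathfrak h}:\mathfrak h\to\mathfrak h$ with $H\circ\phi_{\mathfrak g}=\phi_{\mathfrak h}\circ H'$ and $\phi_{\mathfrak h}(\rho(y)u)=\rho(\phi_{\mathfrak g}(y))(\phi_{\mathfrak h}(u))$ for all $y\in\mathfrak g,u\in\mathfrak h$. For a linear map $\mathfrak H:\mathfrak g\to\mathfrak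 h$, $H_t=H+t\mathfrak H$ is a (one-parameter) linear deformation of $H$ if $H_t$ is a crossed homomorphism with respect to $\rho$ for all $t$. It is trivial if there exists $x\in\mathfrak g$ such that $(\mathrm{Id}_{\mathfrak g}+t\,\mathrm{ad}_x,\mathrm{Id}_{\mathfrak h}+t\rho(x))$ is a homomorphism from $H_t$ to $H$ (for all $t$). The representation $\rho_H$ of $\mathfrak g$ on $\mathfrak h$ is $\rho_H(y)u=\rho(y)u+[Hy,u]_{\mathfrak h}$, and $d_{\rho_H}$ is its Chevalley-Eilenberg coboundary operator. An element $x\in\mathfrak g$ is a Nijenhuis element associated to $H$ (written $x\in\mathsf{Nij}(H)$) if: $[[x,y]_{\mathfrak g},[x,z]_{\mathfrak g}]_{\mathfrak g}=0$ for all $y,z\in\mathfrak g$; $[\rho(x)u,\rho(x)v]_{\mathfrak h}=0$ for all $u,v\in\mathfrak h$; $\rho([x,y]_{\mathfrak g})\rho(x)=0$ for all $y\in\mathfrak g$; and $\rho(x)\big(\rho(y)Hx+[Hy,Hx]_{\mathfrak h}\big)=0$ for all $y\in\mathfrak g$. *)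

(* Defs.v *)
From HB Require Import structures.
From mathcomp Require Import all_boot all_order all_algebra.

Set Implicit Arguments.
Unset Strict Implicit.
Unset Printing Implicit Defensive.

Import GRing.Theory.
Local Open Scope ring_scope.

(* Lie algebras of arbitrary, possibly infinite, dimension. *)
HB.mixin Record Lmodule_isLieAlgebra (K : nzRingType) V
    of GRing.Lmodule K V := {
  lie_bracket : V -> V -> V;
  lie_linearl : forall y : V, linear (lie_bracket^~ y);
  lie_linearr : forall x : V, linear (lie_bracket x);
  lie_alternating : forall x : V, lie_bracket x x = 0;
  lie_jacobi : forall x y z : V,
    lie_bracket x (lie_bracket y z) + lie_bracket y (lie_bracket z x)
      + lie_bracket z (lie_bracket x y) = 0
}.

#[short(type="lieAlgType")]
HB.structure Definition LieAlgebra (K : nzRingType) :=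
  { V of GRing.Lmodule K V & Lmodule_isLieAlgebra K V }.

Notation "[| x , y |]" := (lie_bracket x y)
  (at level 0, x, y at level 99, format "[| x ,  y |]") : ring_scope.

Section Definitions.
Variables (K : fieldType) (g h : lieAlgType K).

Definition lie_morphism (a b : lieAlgType K) (phi : a -> b) : Prop :=
  linear phi /\ forall x y, phi [|x, y|] = [|phi x, phi y|].

Definition derivation (D : h -> h) : Prop :=
  linear D /\ forall u v, D [|u, v|] = [|D u, v|] + [|u, D v|].

(* A Lie algebra homomorphism from g to gl(V) with the commutator bracket. *)
Definition representation (V : lmodType K) (rho : g -> V -> V) : Prop :=
  [/\ forall x, linear (rho x),
      forall v, linear (rho^~ v)
    & forall x y v, rho [|x, y|] v = rho x (rho y v) - rho y (rho x v)].

(* A Lie algebra homomorphism from g to Der(h), a subalgebra of gl(h). *)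
Definition action (rho : g -> h -> h) : Prop :=
  representation rho /\ forall x, derivation (rho x).

Definition crossed_hom (rho : g -> h -> h) (H : g -> h) : Prop :=
  linear H /\
  forall x y, H [|x, y|] = rho x (H y) - rho y (H x) + [|H x, H y|].

(* (phi_g, phi_h) is a homomorphism from H' to H. *)
Definition crossed_hom_morphism (rho : g -> h -> h) (H' H : g -> h)
    (phi_g : g -> g) (phi_h : h -> h) : Prop :=
  [/\ lie_morphism phi_g,
      lie_morphism phi_h,
      forall y, H (phi_g y) = phi_h (H' y)
    & forall y u, phi_h (rho y u) = rho (phi_g y) (phi_h u)].

Definition deform (H HH : g -> h) (t : K) : g -> h :=
  fun y => H y + t *: HH y.

Definition linear_deformation (rho : g -> h -> h) (H HH : g -> h) : Prop :=
  linear HH /\ forall t : K, crossed_hom rho (deform H HH t).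

Definition trivial_deformation (rho : g -> h -> h) (H HH : g -> h) : Prop :=
  exists x : g, forall t : K,
    crossed_hom_morphism rho (deform H HH t) H
      (fun y => y + t *: [|x, y|]) (fun u => u + t *: rho x u).

(* The representation rho_H. *)
Definition twisted_rep (rho : g -> h -> h) (H : g -> h) : g -> h -> h :=
  fun y u => rho y u + [|H y, u|].

Lemma twisted_rep_representation (rho : g -> h -> h) (H : g -> h) :
  action rho -> crossed_hom rho H -> representation (twisted_rep rho H).
Proof.
have linf (U V : lmodType K) (f : U -> V) : linear f ->
    (forall a b, f (a + b) = f a + f b) /\ (forall a, f (- a) = - f a).
  move=> lf; split=> [a b|a]; first by have := lf 1 a b; rewrite !scale1r.
  have f0 : f 0 = 0.
    have := lf 1 0 0; rewrite !scale1r addr0 => /eqP.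
    by rewrite -subr_eq subrr eq_sym => /eqP.
  by have := lf (- 1) a 0; rewrite !scaleN1r f0 !addr0.
have lD (c : h) := (linf _ _ _ (@lie_linearl _ h c)).1.
have lN (c : h) := (linf _ _ _ (@lie_linearl _ h c)).2.
have rD (c : h) := (linf _ _ _ (@lie_linearr _ h c)).1.
have rN (c : h) := (linf _ _ _ (@lie_linearr _ h c)).2.
have anti (a b : h) : [|a, b|] = - [|b, a|].
  have := lie_alternating (a + b).
  rewrite rD !(lD _) !lie_alternating add0r addr0 => /eqP.
  by rewrite addrC addr_eq0 => /eqP.
move=> [[rl rg rb] rder] [Hl Hb]; split.
- move=> x a u v; rewrite /twisted_rep rl (@lie_linearr _ h) scalerDr.
  by rewrite addrACA.
- move=> v a x y; rewrite /twisted_rep rg Hl (@lie_linearl _ h) scalerDr.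
  by rewrite addrACA.
move=> x y u; rewrite /twisted_rep rb Hb !(lD _) (lN _).
have rhoD z := (linf _ _ _ (rl z)).1.
rewrite !rhoD !(rder _).2 !rD.
have -> : [|[|H x, H y|], u|] = [|H x, [|H y, u|]|] - [|H y, [|H x, u|]|].
  have := lie_jacobi (H x) (H y) u.
  rewrite (anti u (H x)) rN (anti u [|H x, H y|]) => /eqP.
  by rewrite subr_eq0 => /eqP.
rewrite !opprD !addrA; apply/eqP; rewrite -subr_eq0 !opprD !opprK !addrA.
set a1 := rho x (rho y u); set a2 := rho y (rho x u).
set a3 := [|rho x (H y), u|]; set a4 := [|rho y (H x), u|].
set a5 := [|H x, [|H y, u|]|]; set a6 := [|H y, [|H x, u|]|].
set a7 := [|H y, rho x u|]; set a8 := [|H x, rho y u|].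
rewrite (ACl ((1*7)*(12*2)*(3*8)*(13*4)*(5*11)*(16*6)*(15*9)*(14*10)))%AC /=.
by rewrite !subrr !addr0.
Qed.

(* The Chevalley-Eilenberg coboundary of an n-cochain f with values in V.
   Indices start from 0, so the usual sign (-1)^(i+1) of the first sum becomes
   (-1)^i.  The family x with its i-th entry removed is k |-> x (lift i k); for
   i < j, the entries of x other than the i-th and the j-th are, in order, those
   of index bump j (bump i m), and they are preceded by [|x i, x j|]. *)
Definition CE_coboundary (V : lmodType K) (rho : g -> V -> V) (n : nat)
    (f : ('I_n -> g) -> V) (x : 'I_n.+1 -> g) : V :=
  \sum_(i < n.+1) (-1) ^+ i *: rho (x i) (f (fun k => x (lift i k)))
  + \sum_(i < n.+1) \sum_(j < n.+1 | (i < j)%N)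
      (-1) ^+ (i + j) *:
        f (fun k => if k == 0%N :> nat then [|x i, x j|]
                    else x (inord (bump j (bump i k.-1)))).

(* The coboundary of a vector v, viewed as a 0-cochain, as a map on g. *)
Definition CE_coboundary0 (V : lmodType K) (rho : g -> V -> V) (v : V) :
    g -> V :=
  fun y => CE_coboundary rho (fun _ : 'I_0 -> g => v) (fun _ : 'I_1 => y).

Definition nijenhuis (rho : g -> h -> h) (H : g -> h) (x : g) : Prop :=
  [/\ forall y z, [|[|x, y|], [|x, z|]|] = 0,
      forall u v, [|rho x u, rho x v|] = 0,
      forall y u, rho [|x, y|] (rho x u) = 0
    & forall y, rho x (rho y (H x) + [|H y, H x|]) = 0].

End Definitions.

(* Main.v *)
Require Import Defs.
From HB Require Import structures.
From mathcomp Require Import all_boot all_order all_algebra.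

Set Implicit Arguments.
Unset Strict Implicit.
Unset Printing Implicit Defensive.

Import GRing.Theory.
Local Open Scope ring_scope.

(** A [1]-cocycle [HH] of [rho_H] whose values commute with one another deforms
[H], since the terms of degree 1 and 2 in [t] of the crossed homomorphism
equation for [H + t HH] are the cocycle equation and [[HH y, HH z] = 0].
The coboundary of [- H x] is [HH y = H [x, y] - rho x (H y)].  The Nijenhuis
conditions give [rho x (HH z) = 0], and expanding [[HH y, HH z]] with them yields
[- rho x (rho_H y (HH z) - rho_H z (HH y)) = - rho x (HH [y, z]) = 0].
Triviality amounts to the vanishing of the terms of degree 2 in [t], which is
exactly what the Nijenhuis conditions say. *)

Section Linear.
Variables (K : fieldType) (U V : lmodType K) (f : U -> V) (lf : linear f).

Lemma linear_add u v : f (u + v) = f u + f v.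
Proof. by have := lf 1 u v; rewrite !scale1r. Qed.

Lemma linear_zero : f 0 = 0.
Proof. by apply: (addIr (f 0)); rewrite -linear_add !add0r. Qed.

Lemma linear_scale a u : f (a *: u) = a *: f u.
Proof. by have := lf a u 0; rewrite linear_zero !addr0. Qed.

Lemma linear_opp u : f (- u) = - f u.
Proof. by rewrite -scaleN1r linear_scale scaleN1r. Qed.

Lemma linear_sub u v : f (u - v) = f u - f v.
Proof. by rewrite linear_add linear_opp. Qed.

Lemma linear_addZ (k : U -> V) (t : K) :
  linear k -> linear (fun u => f u + t *: k u).
Proof.
move=> lk a u v; rewrite lf lk !scalerDr !scalerA (mulrC t a).
by rewrite addrACA.
Qed.

End Linear.

Section Bracket.
Variables (K : fieldType) (a : lieAlgType K).
Implicit Types u v w : a.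

Lemma lieDl u v w : [|u + v, w|] = [|u, w|] + [|v, w|].
Proof. exact: (linear_add (lie_linearl w)). Qed.
Lemma lieDr u v w : [|w, u + v|] = [|w, u|] + [|w, v|].
Proof. exact: (linear_add (lie_linearr w)). Qed.
Lemma lieNr u w : [|w, - u|] = - [|w, u|].
Proof. exact: (linear_opp (lie_linearr w)). Qed.
Lemma lieZl (t : K) u w : [|t *: u, w|] = t *: [|u, w|].
Proof. exact: (linear_scale (lie_linearl w)). Qed.
Lemma lieZr (t : K) u w : [|w, t *: u|] = t *: [|w, u|].
Proof. exact: (linear_scale (lie_linearr w)). Qed.

Lemma lie_anti u v : [|u, v|] = - [|v, u|].
Proof.
have := lie_alternating (u + v).
rewrite lieDr !lieDl !lie_alternating add0r addr0 => /eqP.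
by rewrite addrC addr_eq0 => /eqP.
Qed.

Lemma derivation_ad u : derivation (lie_bracket u).
Proof.
split=> [ |v w]; first exact: lie_linearr.
have := lie_jacobi u v w.
rewrite (lie_anti w u) lieNr (lie_anti w) => /eqP.
rewrite subr_eq0 => /eqP <-.
by rewrite addrNK.
Qed.

(** The Leibniz rule matches the terms of degree 1 in [t], and the commuting values of [D] remove
    the term of degree 2. It serves both [ad x] on [g] and [rho x] on [h]. *)
Lemma lie_morphism_id_addZ (D : a -> a) (t : K) :
    derivation D -> (forall u v, [|D u, D v|] = 0) ->
  lie_morphism (fun u => u + t *: D u).
Proof.
move=> [lD dD] D0; split; first exact: (@linear_addZ _ _ _ id).
move=> u v; rewrite lieDr !lieDl !lieZl !lieZr D0 !scaler0 addr0.
by rewrite dD scalerDr addrA.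
Qed.

End Bracket.

Lemma CE_coboundary0E (K : fieldType) (g : lieAlgType K) (V : lmodType K)
    (rho : g -> V -> V) (v : V) (y : g) :
  CE_coboundary0 rho v y = rho y v.
Proof.
rewrite /CE_coboundary0 /CE_coboundary !big_ord1 expr0 scale1r.
(* The double sum is empty: the only index in ['I_1] is 0, so [i < j] fails. *)
by rewrite big_pred0 ?addr0 // => j; rewrite (ord1 j).
Qed.

Section CrossedHom.
Variables (K : fieldType) (g h : lieAlgType K) (rho : g -> h -> h).
Hypothesis rho_action : action rho.
Variable H : g -> h.
Hypothesis H_crossed : crossed_hom rho H.

Let rhor y : linear (rho y). Proof. by case: rho_action => [[]]. Qed.
Let rhol u : linear (rho^~ u). Proof. by case: rho_action => [[]]. Qed.
Let rho_lie y z u : rho [|y, z|] u = rho y (rho z u) - rho z (rho y u).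
Proof. by case: rho_action => [[]]. Qed.

Local Notation rhoH := (twisted_rep rho H).

Lemma crossed_hom_deform (HH : g -> h) (t : K) :
    linear HH ->
    (forall y z, HH [|y, z|] = rhoH y (HH z) - rhoH z (HH y)) ->
    (forall y z, [|HH y, HH z|] = 0) ->
  crossed_hom rho (deform H HH t).
Proof.
move=> lHH HH_cocycle HH_comm; have [lH H_lie] := H_crossed.
split=> [ |y z]; first exact: linear_addZ.
rewrite /deform H_lie HH_cocycle /twisted_rep.
rewrite !(linear_add (rhor _)) !(linear_scale (rhor _)).
rewrite lieDr !lieDl !lieZl !lieZr HH_comm !scaler0 addr0.
rewrite (lie_anti (H z)) !(scalerBr, scalerDr, scalerN) !opprD opprK !addrA.
by rewrite [LHS](ACl (1*4*2*6*3*7*5))%AC.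
Qed.

Variable x : g.
Hypothesis x_nij : nijenhuis rho H x.

Variable HH : g -> h.
Hypothesis HHE : forall y, HH y = rhoH y (- H x).

Let rhoH_rep : representation rhoH :=
  twisted_rep_representation rho_action H_crossed.

Lemma coboundaryE y : HH y = - rho y (H x) - [|H y, H x|].
Proof. by rewrite HHE /twisted_rep (linear_opp (rhor _)) lieNr. Qed.

(** The other two terms of the crossed homomorphism equation at [x], [y] are exactly [HH y]. *)
Lemma coboundary_crossedE y : HH y = H [|x, y|] - rho x (H y).
Proof.
rewrite coboundaryE H_crossed.2 (lie_anti (H x)).
by rewrite [RHS](ACl ((1*4)*2*3))%AC /= subrr add0r.
Qed.

Lemma linear_coboundary : linear HH.
Proof. by case: rhoH_rep => _ l _ a y z; rewrite !HHE l. Qed.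

(** This is [d^2 = 0] in degree 0: the representation law of [rhoH] at the vector [- H x]. *)
Lemma coboundary_cocycle y z : HH [|y, z|] = rhoH y (HH z) - rhoH z (HH y).
Proof. by case: rhoH_rep => _ _ b; rewrite !HHE b. Qed.

Lemma rho_coboundary y : rho x (HH y) = 0.
Proof.
case: x_nij => _ _ _ x4.
by rewrite coboundaryE -opprD (linear_opp (rhor _)) x4 oppr0.
Qed.

(** Applying the derivation [rho x] to [[|H y, u|]] leaves only the bracket on the left, because
    [rho x] kills [u]. It is used with [u] a value of [HH]. *)
Lemma nijenhuis_rho_twisted y u : rho x u = 0 ->
  rho [|x, y|] u + [|rho x (H y), u|] = rho x (rhoH y u).
Proof.
move=> u0; rewrite rho_lie u0 (linear_zero (rhor _)) subr0 /twisted_rep.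
rewrite (linear_add (rhor _)) (rho_action.2 x).2 u0.
by rewrite (linear_zero (lie_linearr _)) addr0.
Qed.

Lemma coboundary_commute y z : [|HH y, HH z|] = 0.
Proof.
have [x1 x2 x3 _] := x_nij.
have HxE w : H [|x, w|] = HH w + rho x (H w).
  by rewrite coboundary_crossedE addrNK.
(* The first Nijenhuis condition makes the [H] side zero. Once [HxE] is expanded, the third and
   second remove the terms with two factors [rho x]. *)
have /esym := H_crossed.2 [|x, y|] [|x, z|].
rewrite x1 (linear_zero H_crossed.1) !HxE.
rewrite !(linear_add (rhor _)) !x3 !addr0 lieDr !lieDl x2 addr0.
(* Both mixed brackets now have the shape met in [nijenhuis_rho_twisted]. *)
rewrite (lie_anti (HH y) (rho x _)) => E.
have: [|HH y, HH z|] + rho x (rhoH y (HH z) - rhoH z (HH y)) = 0.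
  rewrite (linear_sub (rhor _)) -!nijenhuis_rho_twisted ?rho_coboundary //.
  by rewrite -[RHS]E opprD !addrA [LHS](ACl (2*4*1*3*5))%AC.
by rewrite -coboundary_cocycle rho_coboundary addr0.
Qed.

Lemma linear_deformation_coboundary : linear_deformation rho H HH.
Proof.
split=> [ |t]; first exact: linear_coboundary.
apply: crossed_hom_deform; first exact: linear_coboundary.
- exact: coboundary_cocycle.
- exact: coboundary_commute.
Qed.

Lemma trivial_deformation_coboundary : trivial_deformation rho H HH.
Proof.
have [x1 x2 x3 _] := x_nij.
exists x => t; split.
- by apply: lie_morphism_id_addZ => //; apply: derivation_ad.
- by apply: lie_morphism_id_addZ => //; apply: rho_action.2.
- move=> y; rewrite (linear_add H_crossed.1) (linear_scale H_crossed.1).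
  rewrite /deform (linear_add (rhor _)) (linear_scale (rhor _)).
  rewrite rho_coboundary scaler0 addr0 coboundary_crossedE.
  by rewrite -addrA -scalerDr addrNK.
- move=> y u; rewrite (linear_add (rhol _)) (linear_scale (rhol _)).
  rewrite !(linear_add (rhor _)) !(linear_scale (rhor _)) x3 scaler0 addr0.
  (* Only degree 1 in [t] remains: [rho x] past [rho y] costs the commutator [rho [|x, y|]]. *)
  by rewrite rho_lie -addrA -scalerDr subrKC.
Qed.

End CrossedHom.

Theorem theorem5p14 (K : closedFieldType) (charK0 : [pchar K] =i pred0)
    (g h : lieAlgType K) (rho : g -> h -> h) (rho_action : action rho)
    (H : g -> h) (H_crossed : crossed_hom rho H)
    (x : g) (x_nij : nijenhuis rho H x) :
  let HH : g -> h := CE_coboundary0 (twisted_rep rho H) (- H x) in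
  [/\ forall y : g, HH y = - rho y (H x) - [|H y, H x|],
      linear_deformation rho H HH
    & trivial_deformation rho H HH].
Proof.
move=> HH.
have HHE y : HH y = twisted_rep rho H y (- H x) by exact: CE_coboundary0E.
split=> [y||].
- exact: (coboundaryE rho_action HHE).
- exact: (linear_deformation_coboundary rho_action H_crossed x_nij HHE).
- exact: (trivial_deformation_coboundary rho_action H_crossed x_nij HHE).
Qed.
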